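(* Let $e\ge 4$ and consider the map $$\Phi:(\operatorname{Aut}(U_{2^e},\cdot),\circ)\to (V_e,\star),\qquad \chi_{2^e,(t_1,t_2,t_3)}\mapsto \left([t_3]_{2^{e-2}},[t_2]_2,[t_1/2^{e-3}]_2\right),\quad (t_1,t_2,t_3)\in T_{2^e}.$$ Then: (1) $\Phi$ is well-defined and a group isomorphism. (2) When $e=4$, $(\operatorname{Aut}(U_{2^4},\cdot),\circ)$ is isomorphic to the dihedral group of order $8$. More precisely, $V_4\cong\langle r,s\mid rsr=s,\ s^2=1,\ r^4=1\rangle$, where the isomorphism sends $([1]_4,[1]_2,[1]_2)$ to $r$ and $([1]_4,[0]_2,[1]_2)$ to $s$. (3) When $e\ge 5$, there is an isomorphism $$(\operatorname{Aut}(U_{2^e},\cdot),\circ)\cong \mathbb{Z}/2\mathbb{Z}\times\left(D_4\bigcirc_{\iota}\mathbb{Z}/2^{e-4}\mathbb{Z}\right),$$ where the central product is taken with respect to $\iota=(\iota_1,\iota_2)$, with $\iota_1$ and $\iota_2$ the unique injective morphisms from $\mathbb{Z}/2\mathbb{Z}$ into $Z(D_4)$ and $Z(\mathbb{Z}/2^{e-4}\mathbb{Z})$ respectively. More explicitly, $V_e$ decomposes as the internal direct product $$V_e=\langle([-1]_{2^{e-2}},[0]_2,[0]_2)\rangle\times H,\qquad H=\left\{([5]_{2^{e-2}}^w,[a_2]_2,[a_3]_2)\ \middle|\ 0\le w\le 2^{e-4}-1,\ a_2,a_3\in\{0,1\}\right\}.$$ Furthermore, $H$ is the internal central product of the subgroups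 $$H_1=\left\{([5^{2^{e-5}w}]_{2^{e-2}},[a_2]_2,[a_3]_2)\ \middle|\ w\in\{0,1\},\ a_2,a_3\in\{0,1\}\right\}$$ and $$H_2=\left\{([5]_{2^{e-2}}^w,[0]_2,[0]_2)\ \middle|\ 0\le w\le 2^{e-4}-1\right\}.$$ In particular, $|\operatorname{Aut}(U_{2^e},\cdot)|=2^{e-1}$.
   Context: $[a]_n$ is the class of the integer $a$ modulo $n$; $U_n$ is the multiplicative group of invertible classes modulo $n$; $\operatorname{Aut}(U_{2^e},\cdot)$ is its group of automorphisms when $n=2^e$. $D_4$ is the dihedral group of order $8$. For $e\ge4$, $T_{2^e}=\{(t_1,t_2,t_3)\mid t_1\in\{0,2^{e-3}\},\ t_2\in\{0,1\},\ t_3\in\{0,\dots,2^{e-2}-1\},\ \gcd(t_3,2)=1\}$. For $t=(t_1,t_2,t_3)\in T_{2^e}$, $\chi_{2^e,t}$ is the automorphism of $U_{2^e}$ (which is the direct product of $\langle[-1]\rangle$ of order $2$ and $\langle[5]\rangle$ of order $2^{e-2}$) sending $[-1]_{2^e}$ to $[-1]_{2^e}[5]_{2^e}^{t_1}$ and $[5]_{2^e}$ to $[-1]_{2^e}^{t_2}[5]_{2^e}^{t_3}$; all automorphisms of $U_{2^e}$ are of this form. For $e\ge4$, $(V_e,\star)$ is the group with underlying set $V_e=U_{2^{e-2}}\times\mathbb{Z}/2\mathbb{Z}\times\mathbb{Z}/2\mathbb{Z}$ and operation $$([a_1]_{2^{e-2}},[a_2]_2,[a_3]_2)\star([a_1']_{2^{e-2}},[a_2']_2,[a_3']_2)=([a_1a_1'+2^{e-3}a_3a_2']_{2^{e-2}},[a_2+a_2']_2,[a_3+a_3']_2)$$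 for integers $a_i,a_i'$ with $a_1,a_1'$ odd. External central product: given groups $G_1,G_2,C$ and a pair $\iota=(\iota_1,\iota_2)$ of injective homomorphisms $\iota_i:C\hookrightarrow Z(G_i)$, $G_1\bigcirc_\iota G_2=(G_1\times G_2)/\Delta(C)$ with $\Delta(C)=\{(\iota_1(c),\iota_2(c))\mid c\in C\}$. A group $G$ is the internal central product of subgroups $G_1,G_2\le G$ if $G=G_1G_2$ and the elements of $G_1$ commute with the elements of $G_2$. *)

(* Defs.v *)
From HB Require Import structures.
From mathcomp Require Import all_boot all_order all_algebra.
From mathcomp Require Import all_fingroup all_solvable.
(* for a boolean version of the congruence defining a presented group *)
From mathcomp Require Import boolp.

Set Implicit Arguments.
Unset Strict Implicit.
Unset Printing Implicit Defensive.

Import GroupScope GRing.Theory.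

(* The automorphisms of G, with f * g the composite "f after g". The product
   of {perm gT}, hence of the library's group Aut G, composes in the opposite
   order (permM). *)
Definition autc (gT : finGroupType) (G : {group gT}) : Type :=
  {f : {perm gT} | f \in Aut G}.

Section AutComposition.
Variables (gT : finGroupType) (G : {group gT}).

HB.instance Definition _ := SubFinite.on (autc G).

Implicit Types f g h : autc G.

Definition autc_mul f g : autc G :=
  exist _ (val g * val f) (groupM (valP g) (valP f)).
Definition autc_one : autc G := exist _ 1 (group1 _).
Definition autc_inv f : autc G := exist _ (val f)^-1 (groupVr (valP f)).

Fact autc_mulA : associative autc_mul.
Proof. by move=> f g h; apply: val_inj; rewrite /= mulgA. Qed.
Fact autc_mul1 : left_id autc_one autc_mul.
Proof. by move=> f; apply: val_inj; rewrite /= mulg1. Qed.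
Fact autc_mulV : left_inverse autc_one autc_inv autc_mul.
Proof. by move=> f; apply: val_inj; rewrite /= mulgV. Qed.

HB.instance Definition _ :=
  Finite_isGroup.Build (autc G) autc_mulA autc_mul1 autc_mulV.

Lemma autcM f g x : val (f * g) x = val f (val g x).
Proof. by rewrite /= permM. Qed.

End AutComposition.

Notation autU e := (autc (units_Zp (2 ^ e))).

(* The class of a in the unit group modulo n, meant for a coprime to n
   (it is the junk value 1 otherwise). *)
Definition ucls (n : nat) (a : int) : {unit 'Z_n} :=
  insubd (1 : {unit 'Z_n}) (a%:~R : 'Z_n)%R.

Lemma natr_unit_2exp k m : odd m -> (m%:R : 'Z_(2 ^ k))%R \is a GRing.unit.
Proof.
move=> m_odd; case: k => [|k].
  by rewrite -[m]odd_double_half m_odd natrD -muln2 natrM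
    (_ : 2%:R = 0 :> 'Z_(2 ^ 0))%R ?mulr0 ?addr0 ?unitr1 //; apply/eqP.
by rewrite unitZpE ?(ltn_exp2l 0) // coprime_sym coprimeXr // coprimen2.
Qed.

Lemma val_ucls k a : odd `|a|%N -> val (ucls (2 ^ k) a) = (a%:~R)%R.
Proof.
move=> a_odd; rewrite val_insubd.
suff ->: (a%:~R : 'Z_(2 ^ k))%R \is a GRing.unit by [].
case: a a_odd => m a_odd; first exact: natr_unit_2exp.
by rewrite NegzE mulrNz unitrN; apply: natr_unit_2exp.
Qed.

Definition exptriple (e : nat) : pred (nat * nat * nat) :=
  fun t => let: (t1, t2, t3) := t in
  [&& t1 \in [:: 0; 2 ^ (e - 3)], t2 \in [:: 0; 1],
      t3 < 2 ^ (e - 2) & gcdn t3 2 == 1]%N.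

(* f is the automorphism chi_t: [-1] and [5] generate the unit group. *)
Definition chi_spec (e : nat) (t : nat * nat * nat) (f : autU e) : Prop :=
  let: (t1, t2, t3) := t in
  let m1 := ucls (2 ^ e) (- 1)%R in let five := ucls (2 ^ e) 5 in
  val f m1 = m1 * five ^+ t1 /\ val f five = m1 ^+ t2 * five ^+ t3.

(* He is a parameter because the product of V_e (V_mul below) has an
   invertible first component only for e >= 4. *)
Record V (e : nat) (He : 4 <= e) := MkV {
  v1 : {unit 'Z_(2 ^ (e - 2))};
  v2 : 'Z_2;
  v3 : 'Z_2
}.

Section VGroup.
Variables (e : nat) (He : 4 <= e).
Local Notation V := (V He).
Local Notation Zq := 'Z_(2 ^ (e - 2)).

Definition V_to (x : V) := (v1 x, v2 x, v3 x).
Definition V_of (t : {unit Zq} * 'Z_2 * 'Z_2) : V :=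
  let: (a, b, c) := t in MkV He a b c.
Fact V_toK : cancel V_to V_of. Proof. by case. Qed.

HB.instance Definition _ := Finite.copy V (can_type V_toK).

Local Notation h := ((2 ^ (e - 3))%:R : Zq)%R.

Fact V_double : (h * 2%:R = 0)%R.
Proof.
rewrite -natrM mulnC -expnS.
have ->: (e - 3).+1 = e - 2 by rewrite -subSn ?subSS //; apply: leq_trans He.
by rewrite pchar_Zp // (ltn_exp2l 0) // subn_gt0; apply: leq_trans He.
Qed.

Fact V_parity m : (h * m%:R = h * (odd m)%:R)%R.
Proof.
by rewrite -{1}[m]odd_double_half natrD mulrDr -mul2n natrM mulrA V_double
  mul0r addr0.
Qed.

Fact V_parity_val m (u : {unit Zq}) : (h * m%:R * val u = h * m%:R)%R.
Proof.
have u_odd: odd (val u : Zq).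
  have := valP u; rewrite -{1}[val u]natr_Zp unitZpE.
    by rewrite coprime_pexpl ?coprime2n // subn_gt0 (leq_trans _ He).
  by rewrite (ltn_exp2l 0) // subn_gt0 (leq_trans _ He).
rewrite mulrAC -[val u in LHS]natr_Zp.
by rewrite [(h * _)%R in LHS]V_parity u_odd mulr1.
Qed.

Fact V_unit (a : {unit Zq}) m : (val a + h * m%:R)%R \is a GRing.unit.
Proof.
have sq0: (h * m%:R * (h * m%:R) = 0)%R.
  have [k def_k]: exists k, (2 ^ (e - 3) = 2 * k)%N.
    exists (2 ^ (e - 4))%N; by rewrite -expnS -subSn // subSS.
  by rewrite {2}def_k natrM !mulrA -[X in (X * k%:R * _)%R]mulrA
    [(m%:R * 2%:R)%R]mulrC mulrA V_double !mul0r.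
rewrite -(V_parity_val m a) -[X in (X + _)%R]mul1r -mulrDl.
rewrite unitrMl ?(valP a) //; apply/unitrP; exists (1 - h * m%:R)%R.
have sub1 (x : Zq) : (x * x = 0 -> (1 + x) * (1 - x) = 1)%R.
  by move=> x2; rewrite mulrBr mulr1 mulrDl mul1r x2 addr0 addrK.
by rewrite mulrC sub1.
Qed.

Definition V_mul (x y : V) : V :=
  MkV He (FinRing.Unit (V_unit (v1 x * v1 y) (v3 x * v2 y)%N))
    (v2 x + v2 y)%R (v3 x + v3 y)%R.
Definition V_one : V := MkV He 1 0%R 0%R.
Definition V_inv (x : V) : V :=
  MkV He (FinRing.Unit (V_unit (v1 x)^-1 (v3 x * v2 x)%N))
    (- v2 x)%R (- v3 x)%R.

Fact V_inj (x y : V) :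
  val (v1 x) = val (v1 y) -> v2 x = v2 y -> v3 x = v3 y -> x = y.
Proof. by case: x y => [a b c] [a' b' c'] /= /val_inj-> -> ->. Qed.

Fact V_mulE (x y : V) :
  val (v1 (V_mul x y)) = (val (v1 x) * val (v1 y) + h * (v3 x * v2 y)%:R)%R.
Proof. by []. Qed.

Fact V_mulA : associative V_mul.
Proof.
have hD (a b c : 'Z_2) :
    (h * ((a + b)%R * c)%N%:R = h * (a * c)%N%:R + h * (b * c)%N%:R)%R /\
    (h * (c * (a + b)%R)%N%:R = h * (c * a)%N%:R + h * (c * b)%N%:R)%R.
  by split; rewrite -mulrDr -natrD V_parity [in RHS]V_parity;
    congr (h * _%:R)%R;
    case: a b c => [[|[|a]] ?] [[|[|b]] ?] [[|[|c]] ?].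
move=> x y z; apply: V_inj; rewrite /= ?addrA //.
rewrite !(mulrDl, mulrDr) (hD _ _ _).1 (hD _ _ _).2.
rewrite V_parity_val [(val (v1 x) * (h * _))%R]mulrC V_parity_val.
by rewrite !mulrA -!addrA; congr (_ + _)%R; rewrite addrC -addrA.
Qed.

Fact V_mul1 : left_id V_one V_mul.
Proof.
by move=> x; apply: V_inj; rewrite ?V_mulE /= ?add0r ?mul1r ?mul0n ?mulr0 ?addr0.
Qed.

Fact V_mulV : left_inverse V_one V_inv V_mul.
Proof.
move=> x; have v3N: (- v3 x = v3 x)%R.
  by case: (v3 x) => [[|[|c]] ?] //; apply: val_inj.
apply: V_inj; [rewrite V_mulE /V_inv v3N /= | exact: addNr | exact: addNr].
rewrite mulrDl V_parity_val mulVr ?(valP (v1 x)) // -addrA -mulrDr.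
by rewrite -natrD addnn -muln2 natrM mulrCA V_double mulr0 addr0.
Qed.

HB.instance Definition _ := Finite_isGroup.Build V V_mulA V_mul1 V_mulV.

(* ([a1], [a2], [a3]) for an integer a1 prime to 2 ^ (e - 2). *)
Definition Vcls (a1 : int) (a2 a3 : nat) : V :=
  MkV He (ucls (2 ^ (e - 2)) a1) (a2%:R)%R (a3%:R)%R.

End VGroup.

(* The group presented by generators X and relations R, as the quotient of
   the words in letters (x, false) for x and (x, true) for x^-1. *)
Section Presentation.
Variable X : choiceType.
Notation word := (seq (X * bool)).
Variable R : seq (word * word).

Inductive pres_cong : word -> word -> Prop :=
| PresRel u v : (u, v) \in R -> pres_cong u v
| PresInv x b : pres_cong [:: (x, b); (x, ~~ b)] [::]
| PresCat u u' v v' :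
    pres_cong u u' -> pres_cong v v' -> pres_cong (u ++ v) (u' ++ v')
| PresRefl u : pres_cong u u
| PresSym u v : pres_cong u v -> pres_cong v u
| PresTrans u v w : pres_cong u v -> pres_cong v w -> pres_cong u w.

Definition pres_rel : rel word := fun u v => `[< pres_cong u v >].

Fact pres_rel_equiv : equiv_class_of pres_rel.
Proof.
split=> [u|u v|v u w]; rewrite /pres_rel.
- exact/asboolP/PresRefl.
- by apply/asboolP/asboolP; apply: PresSym.
- by move=> /asboolP uv /asboolP vw; apply/asboolP/(PresTrans uv).
Qed.

Canonical pres_equiv := EquivRelPack pres_rel_equiv.

Definition pres : Type := {eq_quot pres_equiv}%qT.
HB.instance Definition _ := Choice.on pres.

Definition pres_class (u : word) : pres := (\pi_{eq_quot pres_equiv} u)%qT.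
Definition pres_repr (a : pres) : word := generic_quotient.repr (a : {eq_quot pres_equiv}%qT).
Definition pres_gen (x : X) : pres := pres_class [:: (x, false)].

Fact pres_classP u v : pres_class u = pres_class v <-> pres_cong u v.
Proof. by split=> [/eqmodP/asboolP // | uv]; apply/eqmodP/asboolP. Qed.

Fact pres_reprK a : pres_class (pres_repr a) = a.
Proof. exact: reprK. Qed.

Fact pres_repr_cong u : pres_cong (pres_repr (pres_class u)) u.
Proof. by apply/pres_classP; rewrite pres_reprK. Qed.

Definition inv_word (u : word) : word := rev [seq (l.1, ~~ l.2) | l <- u].

Fact inv_word_cong u : pres_cong (inv_word u ++ u) [::].
Proof.
elim: u => [|[x b] u IHu]; first exact: PresRefl.
rewrite /inv_word map_cons rev_cons cat_rcons; apply: PresTrans IHu.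
apply: PresCat (PresRefl _) _; rewrite -cat1s -[(x, b) :: u]cat1s catA.
rewrite -[X in pres_cong _ X]cat0s; apply: PresCat (PresRefl _).
by have := PresInv x (~~ b); rewrite negbK.
Qed.

Definition pres_mul (a b : pres) : pres :=
  pres_class (pres_repr a ++ pres_repr b).
Definition pres_inv (a : pres) : pres := pres_class (inv_word (pres_repr a)).

Fact pres_mul_class u v :
  pres_mul (pres_class u) (pres_class v) = pres_class (u ++ v).
Proof. by apply/pres_classP/PresCat; apply: pres_repr_cong. Qed.

Fact pres_mulA : associative pres_mul.
Proof.
move=> a b c; rewrite -[a]pres_reprK -[b]pres_reprK -[c]pres_reprK.
by rewrite !pres_mul_class catA.
Qed.

Fact pres_mul1 : left_id (pres_class [::]) pres_mul.
Proof. by move=> a; rewrite -[a]pres_reprK pres_mul_class. Qed.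

Fact pres_mulr1 : right_id (pres_class [::]) pres_mul.
Proof. by move=> a; rewrite -[a]pres_reprK pres_mul_class cats0. Qed.

Fact pres_mulV : left_inverse (pres_class [::]) pres_inv pres_mul.
Proof.
move=> a; rewrite -{2}[a]pres_reprK pres_mul_class.
exact/pres_classP/inv_word_cong.
Qed.

Fact pres_mulrV : right_inverse (pres_class [::]) pres_inv pres_mul.
Proof.
move=> a; rewrite -[RHS](pres_mulV (pres_inv a)).
rewrite -[X in pres_mul X _]pres_mul1 -{1}(pres_mulV (pres_inv a)).
by rewrite -!pres_mulA [pres_mul (pres_inv a) (pres_mul _ _)]pres_mulA
  pres_mulV pres_mul1.
Qed.

HB.instance Definition _ := isGroup.Build pres
  pres_mulA pres_mul1 pres_mulr1 pres_mulV pres_mulrV.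

End Presentation.

(* < r, s | rsr = s, s^2 = 1, r^4 = 1 >, with r = true and s = false *)
Definition rs_group : groupType :=
  let r := (true, false) in let s := (false, false) in
  pres [:: ([:: r; s; r], [:: s]); ([:: s; s], [::]); ([:: r; r; r; r], [::])].
Definition rs_r : rs_group := pres_gen _ true.
Definition rs_s : rs_group := pres_gen _ false.

(* An injective morphism from C into the centre of G. *)
Definition central_embedding (C G : finGroupType) (i : C -> G) : Prop :=
  [/\ {morph i : c d / c * d}, injective i & forall c, i c \in 'Z([set: G])].

(* The external central product of G1 and G2 along i1 and i2; unlike the
   library's xcprod, i1 and i2 need not be onto the centres. *)
Definition central_diag (C G1 G2 : finGroupType) (i1 : C -> G1) (i2 : C -> G2)
  : {set G1 * G2} := [set (i1 c, i2 c) | c : C].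
Definition ext_cprod (C G1 G2 : finGroupType) (i1 : C -> G1) (i2 : C -> G2) :=
  [set: G1 * G2] / central_diag i1 i2.

Section VSubgroups.
Variables (e : nat) (He : 4 <= e).

Definition V_H : {set V He} :=
  [set x | [exists w : 'I_(2 ^ (e - 4)), exists a2 : 'I_2, exists a3 : 'I_2,
     x == MkV He (ucls (2 ^ (e - 2)) 5 ^+ w) (a2%:R)%R (a3%:R)%R]].
Definition V_H1 : {set V He} :=
  [set x | [exists w : 'I_2, exists a2 : 'I_2, exists a3 : 'I_2,
     x == Vcls He (5%:Z ^+ (2 ^ (e - 5) * w))%R a2 a3]].
Definition V_H2 : {set V He} :=
  [set x | [exists w : 'I_(2 ^ (e - 4)), x == MkV He (ucls (2 ^ (e - 2)) 5 ^+ w) 0%R 0%R]].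

End VSubgroups.

(* Main.v *)
(* U_(2^e) = <-1> x <5> with <5> of order 2^(e-2), because
   5^(2^j) = 1 + 2^(j+2) c with c odd. An automorphism sends -1 to -1 * 5^t1,
   where 5^t1 has order at most 2, since -1 is an involution and not a square,
   and 5 to (-1)^t2 * 5^t3 with t3 odd, since otherwise the order would drop.
   Conversely all these choices give automorphisms, and their composition is
   the product of V_e.

   In V_e the elements ([1], [0], [1]) and ([1], [1], [0]) are involutions
   whose commutator is the central involution ([1 + 2^(e-3)], [0], [0]); they
   generate a dihedral group of order 8, which is V_4 for e = 4 and H_1 for
   e >= 5. In the latter case 1 + 2^(e-3) = 5^(2^(e-5)) modulo 2^(e-2), so this
   dihedral group meets the central subgroup H_2 = <5> in its centre, and [-1]
   splits off. *)
Require Import Defs.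
From HB Require Import structures.
From mathcomp Require Import all_boot all_order all_algebra.
From mathcomp Require Import all_fingroup all_solvable.
From mathcomp Require Import boolp ring.

Set Implicit Arguments.
Unset Strict Implicit.
Unset Printing Implicit Defensive.

Import GroupScope GRing.Theory.

Local Notation neg1 k := (ucls (2 ^ k) (- 1)%R).
Local Notation five k := (ucls (2 ^ k) 5).

(** * The unit group modulo a power of two *)

(** Squaring 1 + 2^(j+2) c gives 1 + 2^(j+3) (c + 2^(j+1) c^2), and the new cofactor is odd again
    because 2^(j+1) is even. *)
Lemma expn5_exp2 j : exists2 c, odd c & (5 ^ (2 ^ j) = 1 + 2 ^ j.+2 * c)%N.
Proof.
elim: j => [|j [c c_odd IHj]]; first by exists 1%N.
exists (c + 2 ^ j.+1 * c ^ 2)%N; first by rewrite oddD oddM oddX c_odd.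
rewrite expnSr expnM IHj sqrnD mul1n exp1n -addnA mulnDr mulnA -expnS.
congr (1 + _)%N; rewrite addnC; congr (_ + _)%N.
rewrite expnMn mulnA -expnM -expnSr -expnD; congr (2 ^ _ * _)%N.
by rewrite muln2 -addnn !addSn !addnS.
Qed.

Lemma order_exp2 (gT : finGroupType) (x : gT) j :
  x ^+ (2 ^ j) != 1 -> x ^+ (2 ^ j.+1) = 1 -> #[x] = (2 ^ j.+1)%N.
Proof.
move=> xj_neq1 /eqP; rewrite -order_dvdn => /dvdn_pfactor[] // i le_ij ox.
move: le_ij; rewrite leq_eqVlt => /predU1P[<- // | lt_ij].
case/eqP: xj_neq1; apply/eqP; rewrite -order_dvdn ox.
by rewrite dvdn_exp2l.
Qed.

Lemma Zp_exp2_eq0 k (m : nat) : 0 < k ->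
  ((m%:R : 'Z_(2 ^ k)) == 0)%R = (2 ^ k %| m)%N.
Proof.
move=> k_gt0; have k_gt1: (1 < 2 ^ k)%N by rewrite (ltn_exp2l 0).
by rewrite -val_eqE /= val_Zp_nat // /dvdn.
Qed.

Lemma Zp_exp2_eq k (m n : nat) : 0 < k ->
  ((m%:R : 'Z_(2 ^ k)) == n%:R)%R = (m == n %[mod 2 ^ k])%N.
Proof.
move=> k_gt0; have k_gt1: (1 < 2 ^ k)%N by rewrite (ltn_exp2l 0).
by rewrite -val_eqE /= !val_Zp_nat.
Qed.

Lemma Zp_exp2_eqN1 k (m : nat) : 0 < k ->
  ((-1 : 'Z_(2 ^ k)) == m%:R)%R = (2 ^ k %| m.+1)%N.
Proof.
by move=> k_gt0; rewrite eq_sym -subr_eq0 opprK natr1 Zp_exp2_eq0.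
Qed.

Lemma val_five k : val (five k) = 5%:R%R.
Proof. by rewrite val_ucls. Qed.

Lemma val_neg1 k : val (neg1 k) = (-1)%R.
Proof. by rewrite val_ucls. Qed.

Lemma val_fiveX k j : val (five k ^+ j) = (5 ^ j)%:R%R.
Proof. by rewrite FinRing.val_unitX val_five natrX. Qed.

(** An odd cofactor c contributes only 2^(k+2) modulo 2^(k+3). The value is the involution of the
    cyclic group of 5. *)
Lemma five_exp_half k :
  val (five k.+3 ^+ (2 ^ k)) = (1 + 2 ^ k.+2)%:R%R.
Proof.
rewrite val_fiveX; have [c c_odd ->] := expn5_exp2 k.
apply/eqP; rewrite Zp_exp2_eq // eqn_modDl -[c]odd_double_half c_odd.
rewrite mulnDr muln1 -mul2n mulnA.
by rewrite -expnSr addnC mulnC modnMDl.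
Qed.

Lemma order_five k : 1 < k -> #[five k] = (2 ^ (k - 2))%N.
Proof.
case: k => [|[|[|k]]] // _.
  (* Modulo 4 the class of 5 is trivial. *)
  by apply/eqP; rewrite order_eq1 -val_eqE /= val_five.
rewrite !subSS subn0; apply: order_exp2.
  rewrite -val_eqE /= five_exp_half.
  rewrite -[1%R]/(1%:R)%R Zp_exp2_eq // -{2}[1%N]addn0 eqn_modDl.
  by rewrite mod0n modn_small ?ltn_exp2l // expn_eq0.
apply: val_inj; rewrite /= val_fiveX; have [c _ ->] := expn5_exp2 k.+1.
apply/eqP; rewrite -[1%R]/(1%:R)%R Zp_exp2_eq // -{2}[1%N]addn0 eqn_modDl mod0n.
by rewrite modnMr.
Qed.

Lemma order_neg1 k : 1 < k -> #[neg1 k] = 2.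
Proof.
move=> k_gt1; apply: nt_prime_order => //.
  by apply: val_inj; rewrite FinRing.val_unitX val_neg1 /= sqrrN expr1n.
rewrite -val_eqE /= val_neg1 -[1%R in X in _ != X]/(1%:R)%R.
rewrite Zp_exp2_eqN1; last exact: ltnW.
apply/negP => /(dvdn_leq (isT : 0 < 2)).
by rewrite (@leq_exp2l 2 k 1) // leqNgt k_gt1.
Qed.

(** Powers of 5 are 1 modulo 4 while -1 is not, so the two cyclic groups meet trivially; their
    orders 2 and 2^(k-2) multiply to the totient of 2^k. *)
Lemma unit_exp2_dprod k : 1 < k ->
  <[neg1 k]> \x <[five k]> = units_Zp (2 ^ k).
Proof.
move=> k_gt1; have ti: <[neg1 k]> :&: <[five k]> = 1.
  apply: prime_TIg; rewrite -?orderE ?order_neg1 // cycle_subG.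
  apply/negP => /cycleP[j] /(congr1 val); rewrite val_fiveX val_neg1 => /eqP.
  rewrite Zp_exp2_eqN1; last exact: ltnW.
  move/(dvdn_trans (dvdn_exp2l 2 k_gt1)).
  by rewrite /dvdn -addn1 -modnDml -modnXm exp1n.
rewrite dprodE //; last first.
  by rewrite cents_cycle // /commute; apply: val_inj; rewrite /= mulrC.
apply/eqP; rewrite eqEcard subsetT TI_cardMg // -!orderE order_neg1 //.
rewrite order_five // card_units_Zp ?expn_gt0 //.
rewrite totient_pfactor ?(ltnW k_gt1) //.
by rewrite mul1n -expnS -subSn // subSS subn1 leqnn.
Qed.

(** * Automorphisms of Z/2 x Z/2^(n+2) *)

Section TwoGenerators.
Variables (gT : finGroupType) (G : {group gT}) (a b : gT) (n : nat).
Hypothesis defG : <[a]> \x <[b]> = G.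
Hypothesis oa : #[a] = 2.
Hypothesis ob : #[b] = (2 ^ n.+2)%N.

Lemma gen_commute : commute a b.
Proof.
case/dprodP: defG => _ _ /centsP cba _.
by apply/commute_sym/cba; apply: cycle_id.
Qed.

Lemma gen_mem_l : a \in G.
Proof. by have /dprodW <- := defG; exact/(subsetP (mulG_subl _ _))/cycle_id. Qed.
Lemma gen_mem_r : b \in G.
Proof.
by case/dprodP: defG => _ <- _ _; apply/mulsgP; exists 1 b; rewrite ?mul1g ?cycle_id.
Qed.

Lemma gen_coords x : x \in G ->
  exists2 i, i < 2 & exists2 j, j < 2 ^ n.+2 & x = a ^+ i * b ^+ j.
Proof.
case/(mem_dprod defG) => _ [_ [/cyclePmin[i lti ->] /cyclePmin[j ltj ->] -> _]].
by rewrite oa in lti; rewrite ob in ltj; exists i => //; exists j.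
Qed.

Lemma gen_coords_eq i j i' j' :
  (a ^+ i * b ^+ j == a ^+ i' * b ^+ j') =
  (i == i' %[mod 2]) && (j == j' %[mod 2 ^ n.+2]).
Proof.
rewrite -ob -oa -!eq_expg_mod_order; apply/eqP/andP=> [eqij | [/eqP-> /eqP-> //]].
have [|x [y [_ _ _ Uxy]]] := mem_dprod defG (_ : a ^+ i * b ^+ j \in G).
  by rewrite groupM ?groupX ?gen_mem_l ?gen_mem_r.
have [-> ->] := Uxy _ _ (mem_cycle a i) (mem_cycle b j) erefl.
by have [-> ->] := Uxy _ _ (mem_cycle a i') (mem_cycle b j') eqij.
Qed.

Lemma gen_coords_eq1 i j :
  (a ^+ i * b ^+ j == 1) = (2 %| i) && (2 ^ n.+2 %| j).
Proof. by have := gen_coords_eq i j 0 0; rewrite !expg0 mulg1 !mod0n. Qed.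

Lemma gen_mulg i j i' j' :
  a ^+ i * b ^+ j * (a ^+ i' * b ^+ j') = a ^+ (i + i') * b ^+ (j + j').
Proof.
have cX k l := commuteX2 k l gen_commute.
by rewrite !mulgA -[_ * _ * a ^+ _]mulgA -cX !mulgA -expgD -mulgA -expgD.
Qed.

Lemma gen_expg i j k : (a ^+ i * b ^+ j) ^+ k = a ^+ (i * k) * b ^+ (j * k).
Proof. by rewrite expgMn ?expgM //; apply/commuteX2/gen_commute. Qed.

(** With e = n + 4, the exponent t1 is 2^(n+1) s, so [s] gives the third coordinate in V_e. The
    parameters are left unreduced, so that composition is polynomial in them. *)
Definition aut_coords (f : autc G) s t2 t3 :=
  val f a = a * b ^+ (2 ^ n.+1 * s) /\ val f b = a ^+ t2 * b ^+ t3.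

Lemma autc_mulg (f : autc G) : {in G &, {morph val f : x y / x * y}}.
Proof. exact/morphicP/Aut_morphic/(valP f). Qed.

Lemma autc_closed (f : autc G) x : x \in G -> val f x \in G.
Proof. by move=> Gx; rewrite (Aut_closed (valP f)). Qed.

Lemma autc_expg (f : autc G) x k : x \in G -> val f (x ^+ k) = val f x ^+ k.
Proof.
move=> Gx; have := morphX (autm_morphism (valP f)) k Gx.
by rewrite /= !autmE.
Qed.

(** On exponent vectors (i, j) the automorphism acts as the matrix with rows (1, t2) and (2^(n+1) s,
    t3), which makes composition a matrix product. *)
Lemma autc_gen (f : autc G) s t2 t3 i j : aut_coords f s t2 t3 ->
  val f (a ^+ i * b ^+ j) =
    a ^+ (i + t2 * j) * b ^+ (2 ^ n.+1 * s * i + t3 * j).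
Proof.
case=> fa fb; rewrite autc_mulg ?groupX ?gen_mem_l ?gen_mem_r //.
rewrite !autc_expg ?gen_mem_l ?gen_mem_r // fa fb -{1}[a]expg1.
by rewrite !gen_expg gen_mulg mul1n.
Qed.

Lemma aut_coords_inj (f g : autc G) s t2 t3 :
  aut_coords f s t2 t3 -> aut_coords g s t2 t3 -> f = g.
Proof.
move=> Hf Hg; apply: val_inj; apply: (eq_Aut (valP f) (valP g)) => x Gx.
by have [i _ [j _ ->]] := gen_coords Gx; rewrite (autc_gen _ _ Hf) (autc_gen _ _ Hg).
Qed.

(** The matrix product, with exponents of a modulo 2 and of b modulo 2^(n+2). Oddness of t3 and t3'
    turns s + t3 s' and t2' + t2 t3' into plain sums modulo 2; the remaining 2^(n+1) s t2' is the
    twist of V_e. *)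
Lemma aut_coordsM (f g : autc G) s t2 t3 s' t2' t3' : odd t3 -> odd t3' ->
  aut_coords f s t2 t3 -> aut_coords g s' t2' t3' ->
  aut_coords (f * g) (s + s') (t2 + t2') (t3 * t3' + 2 ^ n.+1 * s * t2').
Proof.
move=> odd_t3 odd_t3' Hf [ga gb]; split; rewrite autcM ?ga ?gb.
  rewrite -{1 2}[a]expg1 (autc_gen _ _ Hf); apply/eqP; rewrite gen_coords_eq.
  rewrite !modn2 !oddD !oddM oddX /= andbF /=.
  rewrite muln1 mulnCA -mulnDr [(2 ^ n.+2)%N]expnSr -!muln_modr.
  rewrite eqn_pmul2l ?expn_gt0 //.
  by rewrite !modn2 !oddD oddM odd_t3.
rewrite (autc_gen _ _ Hf); apply/eqP; rewrite gen_coords_eq.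
by rewrite !modn2 !oddD oddM odd_t3' andbT addbC addnC !eqxx.
Qed.

Lemma aut_coords_uniq (f : autc G) s t2 t3 s' t2' t3' :
  aut_coords f s t2 t3 -> aut_coords f s' t2' t3' ->
  [/\ s = s' %[mod 2], t2 = t2' %[mod 2] & t3 = t3' %[mod 2 ^ n.+2]].
Proof.
case=> fa fb []; rewrite fa fb => /mulgI/eqP eq_a /eqP.
rewrite gen_coords_eq => /andP[/eqP-> /eqP->]; move: eq_a.
rewrite eq_expg_mod_order ob [(2 ^ n.+2)%N]expnSr -!muln_modr.
by rewrite eqn_pmul2l ?expn_gt0 // => /eqP.
Qed.

(** The proposed images of a and b commute and have orders dividing those of a and b, so they define
    an endomorphism of the direct product; it is injective because t3 is odd, hence bijective. *)
Lemma aut_coords_ex s t2 t3 : odd t3 -> exists f, aut_coords f s t2 t3.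
Proof.
move=> odd_t3; set a' := a * b ^+ (2 ^ n.+1 * s); set b' := a ^+ t2 * b ^+ t3.
have Ea' : a' = a ^+ 1 * b ^+ (2 ^ n.+1 * s) by rewrite expg1.
have oa' : #[a'] %| #[a].
  rewrite order_dvdn oa Ea' gen_expg gen_coords_eq1 mulnAC -expnSr.
  by rewrite dvdn_mull // dvdn_mulr.
have ob' : #[b'] %| #[b].
  rewrite order_dvdn ob gen_expg gen_coords_eq1.
  by apply/andP; split; apply: dvdn_mull; rewrite ?dvdnn ?dvdn_exp.
have cab' : eltm_morphism ob' @* <[b]> \subset 'C(eltm_morphism oa' @* <[a]>).
  rewrite !im_eltm cents_cycle // /commute Ea' !gen_mulg.
  by rewrite [(t2 + _)%N]addnC [(t3 + _)%N]addnC.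
pose f := dprodm_morphism defG cab'.
have fE i j : f (a ^+ i * b ^+ j) =
    a ^+ (i + t2 * j) * b ^+ (2 ^ n.+1 * s * i + t3 * j).
  rewrite /= dprodmE ?mem_cycle //= !eltmE Ea' !gen_expg gen_mulg.
  by rewrite mul1n.
(* For a kernel element, oddness of t3 makes j even, and then the exponent of a makes i even; so
   2^(n+2) divides 2^(n+1) s i, hence t3 j, hence j. *)
have inj_f : 'injm f.
  apply/subsetP=> x /morphpreP[/gen_coords[i _ [j _ ->]]].
  rewrite !inE fE !gen_coords_eq1 => /andP[even_i div_j].
  have even_j : ~~ odd j.
    have: 2 %| 2 ^ n.+1 * s * i + t3 * j by apply: dvdn_trans div_j; rewrite dvdn_exp.
    by rewrite dvdn2 oddD !oddM oddX odd_t3.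
  have{} even_i : 2 %| i.
    by move: even_i; rewrite !dvdn2 oddD oddM (negPf even_j) andbF addbF.
  rewrite even_i -(@Gauss_dvdr _ t3) ?coprimeXl ?coprime2n //.
  rewrite -(@dvdn_addr (2 ^ n.+1 * s * i)) //.
  by rewrite expnSr dvdn_mul ?dvdn_mulr.
have im_f : f @* G = G.
  apply/eqP; rewrite eqEcard card_injm // leqnn andbT.
  apply/subsetP=> _ /morphimP[x _ /gen_coords[i _ [j _ ->]] ->].
  by rewrite fE groupM ?groupX ?gen_mem_l ?gen_mem_r.
exists (exist _ (aut inj_f im_f) (Aut_aut inj_f im_f)); split => /=.
  rewrite autE ?gen_mem_l //; have := fE 1%N 0%N.
  by rewrite expg0 mulg1 expg1 => ->; rewrite !muln0 muln1 !addn0.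
rewrite autE ?gen_mem_r //; have := fE 0%N 1%N.
by rewrite expg0 mul1g expg1 => ->; rewrite !muln1 muln0.
Qed.

Lemma autc_coords (f : autc G) : exists s t2 t3,
  [/\ s < 2, t2 < 2, t3 < 2 ^ n.+2, odd t3 & aut_coords f s t2 t3].
Proof.
have [i lt_i [j lt_j fa]] := gen_coords (autc_closed f gen_mem_l).
have [t2 lt_t2 [t3 lt_t3 fb]] := gen_coords (autc_closed f gen_mem_r).
(* The square of [f a] is trivial, so 2^(n+2) divides 2j. *)
have [s def_j] : exists s, j = (2 ^ n.+1 * s)%N.
  have /eqP : (val f a) ^+ 2 = 1.
    by rewrite -autc_expg ?gen_mem_l // -oa expg_order; exact: (autc_expg f 0 gen_mem_l).
  rewrite fa gen_expg gen_coords_eq1 expnSr dvdn_pmul2r // => /andP[_].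
  by case/dvdnP=> s ->; exists s; rewrite mulnC.
(* If t3 were even, f would kill b^(2^(n+1)), which is not trivial. *)
have odd_t3 : odd t3.
  apply/negPn/negP=> even_t3; have : val f (b ^+ (2 ^ n.+1)) = val f 1.
    rewrite autc_expg ?gen_mem_r // fb gen_expg (autc_expg f 0 gen_mem_l).
    apply/eqP; rewrite gen_coords_eq1 dvdn_mull ?dvdn_exp //.
    by rewrite expnS dvdn_mul // dvdn2.
  move/perm_inj/eqP; rewrite -order_dvdn ob.
  by rewrite gtnNdvd ?expn_gt0 // ltn_exp2l.
exists s, t2, t3; split=> //.
  by move: lt_j; rewrite def_j [(2 ^ n.+2)%N]expnSr ltn_pmul2l ?expn_gt0.
split=> //; rewrite fa def_j; case: i lt_i fa => [_ fa|[|//] _ _]; last by rewrite expg1.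
(* If i were 0, [f a] would be the square of b^(2^n s), so a would be the square of its preimage y;
   but a square has even exponent at a. *)
pose y := (val f)^-1 (b ^+ (2 ^ n * s)).
have Gy : y \in G by rewrite Aut_closed ?groupV ?(valP f) // groupX ?gen_mem_r.
have : val f (y ^+ 2) = val f a.
  by rewrite autc_expg // permKV -expgM fa mul1g def_j mulnAC expnSr.
move/perm_inj/eqP; have [k _ [l _ ->]] := gen_coords Gy.
rewrite gen_expg -[X in _ == X]mulg1 -{2}[a]expg1 -(expg0 b) gen_coords_eq.
by rewrite modnMl.
Qed.
End TwoGenerators.

(** * The isomorphism between Aut(U) and V *)

Lemma val_ucls_nat k m : odd m -> val (ucls (2 ^ k) m) = m%:R%R.
Proof. exact: (@val_ucls k m%:Z). Qed.

Lemma Z2_natr_eq (m n : nat) : ((m%:R : 'Z_2) == n%:R)%R = (m == n %[mod 2])%N.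
Proof. exact: (@Zp_exp2_eq 1). Qed.

Lemma Z2_natr (x : 'Z_2) : exists2 i, i < 2 & x = (i%:R)%R.
Proof. by exists x; rewrite ?natr_Zp //; case: x. Qed.

(* From here on e is written n.+4, so that e - 2 and e - 3 compute to n.+2 and
   n.+1. *)
Section VClasses.
Variables (n : nat) (He : 4 <= n.+4).
Implicit Types a b c : nat.

Lemma V_coords (x : V He) : exists a b c,
  [/\ a < 2 ^ n.+2, b < 2, c < 2, odd a & x = Vcls He a b c].
Proof.
case: x => u y z; have [b lt_b ->] := Z2_natr y; have [c lt_c ->] := Z2_natr z.
have gt1 : 1 < 2 ^ n.+2 by rewrite (ltn_exp2l 0).
have odd_u : odd (val u : 'Z_(2 ^ n.+2)).
  by have := valP u; rewrite -{1}[val u]natr_Zp unitZpE // coprime_pexpl // coprime2n.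
exists (val u : 'Z_(2 ^ n.+2)), b, c; split=> //.
  by rewrite -[X in _ < X](Zp_cast gt1).
by apply: V_inj => //=; rewrite val_ucls_nat // natr_Zp.
Qed.

Lemma Vcls_eq a b c a' b' c' : odd a -> odd a' ->
  (Vcls He a b c == Vcls He a' b' c') =
  [&& a == a' %[mod 2 ^ n.+2], b == b' %[mod 2] & c == c' %[mod 2]].
Proof.
move=> odd_a odd_a'; rewrite -!Z2_natr_eq -Zp_exp2_eq //.
apply/eqP/and3P=> [[eq_a -> ->] | [/eqP eq_a /eqP eq_b /eqP eq_c]].
  by split=> //; rewrite -!val_ucls_nat // eq_a.
by apply: V_inj => //=; rewrite !val_ucls_nat.
Qed.

Lemma VclsM a b c a' b' c' : odd a -> odd a' ->
  Vcls He a b c * Vcls He a' b' c' =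
  Vcls He (a * a' + 2 ^ n.+1 * (c * b'))%N (b + b') (c + c').
Proof.
move=> odd_a odd_a'; apply: V_inj; rewrite /= ?natrD //.
rewrite !val_ucls_nat ?oddD ?oddM ?oddX ?odd_a ?odd_a' //.
(* Modulo 2^(n+2) the twist depends only on a parity, so integers may replace their residues in
   ['Z_2]. *)
have parity m : ((2 ^ n.+1)%:R * m%:R = (2 ^ n.+1)%:R * (odd m)%:R :> 'Z_(2 ^ n.+2))%R.
  exact: V_parity He m.
rewrite natrD; congr (_ + _)%R; first by rewrite natrM.
rewrite [RHS]natrM [LHS]parity [RHS]parity.
by rewrite !oddM !val_Zp_nat // !modn2 !oddb.
Qed.

Lemma Vcls1 : Vcls He 1%N 0 0 = 1.
Proof. by apply: V_inj => //=; rewrite val_ucls_nat. Qed.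
End VClasses.

Section AutClasses.
Variables (n : nat) (He : 4 <= n.+4).

Let defU := unit_exp2_dprod (isT : 1 < n.+4).
Let o1 := order_neg1 (isT : 1 < n.+4).
Let o5 : #[five n.+4] = (2 ^ n.+2)%N := order_five (isT : 1 < n.+4).

(** Writing t1 as 2^(n+1) s makes [chi_spec] convertible to [aut_coords] at s, t2, t3. *)
Lemma exptripleP t1 t2 t3 :
  reflect (exists s, [/\ s < 2, t1 = (2 ^ n.+1 * s)%N, t2 < 2, t3 < 2 ^ n.+2 & odd t3])
    (exptriple n.+4 (t1, t2, t3)).
Proof.
rewrite /exptriple -/(coprime t3 2) coprimen2 !inE.
apply: (iffP and4P) => [[t1P t2P lt_t3 odd_t3] | [s [lt_s -> lt_t2 lt_t3 odd_t3]]].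
  case/orP: t1P => /eqP->; [exists 0%N | exists 1%N];
    by split; rewrite ?muln0 ?muln1 //; case/orP: t2P => /eqP->.
split=> //; last by case: t2 lt_t2 => [|[]].
by case: s lt_s => [|[|//]] _; rewrite ?muln0 ?muln1 eqxx ?orbT.
Qed.

Lemma chi_exists t : exptriple n.+4 t -> exists! f : autU n.+4, chi_spec t f.
Proof.
case: t => [[t1 t2] t3] /exptripleP[s [_ -> _ _ odd_t3]].
have [f Hf] := aut_coords_ex defU o1 o5 s t2 odd_t3.
exists f; split=> // g Hg; exact: (aut_coords_inj defU o1 o5 Hf Hg).
Qed.

Lemma chi_surj (f : autU n.+4) : exists2 t, exptriple n.+4 t & chi_spec t f.
Proof.
have [s [t2 [t3 [lt_s lt_t2 lt_t3 odd_t3 Hf]]]] := autc_coords defU o1 o5 f.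
exists ((2 ^ n.+1 * s)%N, t2, t3) => //.
by apply/exptripleP; exists s.
Qed.

Lemma Phi_exists : exists Phi : autU n.+4 -> V He,
  [/\ forall t1 t2 t3 (f : autU n.+4),
        exptriple n.+4 (t1, t2, t3) -> chi_spec (t1, t2, t3) f ->
        Phi f = Vcls He t3 t2 (t1 %/ 2 ^ n.+1),
      {morph Phi : f g / f * g}
    & bijective Phi].
Proof.
have /choice[T TP] (f : autU n.+4) : exists t : nat * nat * nat,
    [/\ t.1.1 < 2, t.1.2 < 2, t.2 < 2 ^ n.+2, odd t.2
      & aut_coords (neg1 n.+4) (five n.+4) n f t.1.1 t.1.2 t.2].
  by have [s [t2 [t3 Hf]]] := autc_coords defU o1 o5 f; exists (s, t2, t3).
pose Phi f := Vcls He (T f).2 (T f).1.2 (T f).1.1.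
(* Coordinates of one automorphism agree modulo 2, 2 and 2^(n+2), which is all that [Vcls] sees, so
   the choice made by [T] is immaterial. *)
have PhiE f s t2 t3 : odd t3 ->
    aut_coords (neg1 n.+4) (five n.+4) n f s t2 t3 -> Phi f = Vcls He t3 t2 s.
  move=> odd_t3 Hf; have [_ _ _ odd_Tf HTf] := TP f.
  have [eq1 eq2 eq3] := aut_coords_uniq defU o1 o5 HTf Hf.
  by apply/eqP; rewrite Vcls_eq // eq1 eq2 eq3 !eqxx.
exists Phi; split.
- move=> t1 t2 t3 f /exptripleP[s [_ -> _ _ odd_t3]] Hf.
  by rewrite mulKn ?expn_gt0 //; apply: PhiE.
- move=> f g; have [_ _ _ odd_Tf Hf] := TP f; have [_ _ _ odd_Tg Hg] := TP g.
  rewrite (PhiE _ _ _ _ _ (aut_coordsM defU o1 o5 odd_Tf odd_Tg Hf Hg)).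
    by rewrite VclsM // !mulnA.
  by rewrite oddD !oddM odd_Tf odd_Tg oddX.
have /choice[Psi PsiP] (x : V He) : exists f : autU n.+4, Phi f = x.
  have [a [b [c [_ _ _ odd_a ->]]]] := V_coords x.
  by have [f Hf] := aut_coords_ex defU o1 o5 c b odd_a; exists f; apply: PhiE Hf.
(* Coordinates in the chosen ranges are determined by their classes, so f and [Psi (Phi f)] have the
   same ones. *)
exists Psi => // f; have [lt1 lt2 lt3 odd_f Hf] := TP f.
have [lt1' lt2' lt3' odd_f' Hf'] := TP (Psi (Phi f)).
have /eqP := PsiP (Phi f); rewrite Vcls_eq // !modn_small //.
case/and3P=> /eqP e1 /eqP e2 /eqP e3; move: Hf'; rewrite e1 e2 e3 => Hf'.
exact: (aut_coords_inj defU o1 o5 Hf' Hf).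
Qed.

Lemma card_V : #|[set: V He]| = (2 ^ n.+3)%N.
Proof.
have <-: #|{: {unit 'Z_(2 ^ n.+2)} * 'Z_2 * 'Z_2}| = (2 ^ n.+3)%N.
  have cardU : #|{: {unit 'Z_(2 ^ n.+2)}}| = (2 ^ n.+1)%N.
    by rewrite -cardsT card_units_Zp ?expn_gt0 // totient_pfactor // mul1n.
  by rewrite !card_prod cardU !card_ord -!expnSr.
rewrite cardsT; apply: (@bij_eq_card _ _ (@V_to _ He)).
by exists (@V_of _ He) => [[] | [[]]].
Qed.
End AutClasses.

(** * The dihedral subgroup of V *)

Lemma bij_morph_isog (gT rT : finGroupType) (f : gT -> rT) :
  {morph f : x y / x * y} -> bijective f -> [set: gT] \isog [set: rT].
Proof.
move=> fM bij_f; apply/isogP; exists (Morphism (in2W fM : {in [set: gT] &, _})).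
  by apply/injmP=> x y _ _ /(bij_inj bij_f).
apply/setP=> y; rewrite inE; have [g _ fK] := bij_f; rewrite -[y]fK.
exact: mem_morphim.
Qed.

Section DihedralPart.
Variables (n : nat) (He : 4 <= n.+4).
Implicit Types w a b : nat.

(* The first component is [1 + 2^(e-3)]^w. *)
Definition Vdih w a b := Vcls He (1 + 2 ^ n.+1 * w)%N a b.

Lemma Vdih_odd w : odd (1 + 2 ^ n.+1 * w).
Proof. by rewrite oddD oddM oddX. Qed.

Lemma Vdih_eq w a b w' a' b' : (Vdih w a b == Vdih w' a' b') =
  [&& w == w' %[mod 2], a == a' %[mod 2] & b == b' %[mod 2]].
Proof.
rewrite Vcls_eq ?Vdih_odd // eqn_modDl [(2 ^ n.+2)%N]expnSr -!muln_modr.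
by rewrite eqn_pmul2l ?expn_gt0.
Qed.

(** With h = 2^(n+1), h^2 vanishes modulo 2h, so (1 + hw)(1 + hw') reduces to 1 + h(w + w'), and the
    twist adds b a' to the exponent: the law of unitriangular 3 by 3 matrices over Z/2. *)
Lemma VdihM w a b w' a' b' :
  Vdih w a b * Vdih w' a' b' = Vdih (w + w' + b * a') (a + a') (b + b').
Proof.
rewrite /Vdih VclsM ?Vdih_odd //; apply/eqP.
rewrite Vcls_eq ?Vdih_odd //; last by rewrite oddD !oddM !Vdih_odd oddX.
rewrite !eqxx !andbT mulnDl mul1n mulnDr muln1 mulnCA -!mulnA !mulnDr.
set h := (2 ^ n.+1)%N; have -> : (2 ^ n.+2 = 2 * h)%N by rewrite expnS.
have -> : (h * (h * (w * w')) = 2 ^ n * (w * w') * (2 * h))%N.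
  by rewrite {2}/h expnS; ring.
rewrite -[X in _ == X](modnMDl (2 ^ n * (w * w')) _ (2 * h)).
by apply/eqP; congr (_ %% _)%N; ring.
Qed.

Lemma Vdih1 : Vdih 0 0 0 = 1.
Proof. by rewrite /Vdih muln0 addn0 Vcls1. Qed.

Definition Vdih_set : {set V He} :=
  [set x | [exists w : 'I_2, exists a : 'I_2, exists b : 'I_2, x == Vdih w a b]].

Lemma Vdih_mem w a b : Vdih w a b \in Vdih_set.
Proof.
rewrite inE; apply/existsP; exists (inord (w %% 2)); apply/existsP.
exists (inord (a %% 2)); apply/existsP; exists (inord (b %% 2)).
by rewrite Vdih_eq !inordK ?ltn_mod // !modn_mod !eqxx.
Qed.

Lemma Vdih_setP x : reflect (exists w a b, x = Vdih w a b) (x \in Vdih_set).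
Proof.
apply: (iffP idP) => [|[w [a [b ->]]]]; last exact: Vdih_mem.
by rewrite inE => /existsP[w /existsP[a /existsP[b /eqP->]]]; exists w, a, b.
Qed.

Lemma Vdih_group_set : group_set Vdih_set.
Proof.
apply/group_setP; split=> [|_ _ /Vdih_setP[w [a [b ->]]] /Vdih_setP[w' [a' [b' ->]]]].
  by rewrite -Vdih1 Vdih_mem.
by rewrite VdihM Vdih_mem.
Qed.
Canonical Vdih_group := Group Vdih_group_set.

Lemma card_Vdih : #|Vdih_set| = 8.
Proof.
pose f (p : 'I_2 * 'I_2 * 'I_2) := Vdih p.1.1 p.1.2 p.2.
have inj_f : injective f.
  move=> [[w a] b] [[w' a'] b'] /eqP; rewrite Vdih_eq /= !modn_small //.
  by case/and3P=> /eqP/val_inj-> /eqP/val_inj-> /eqP/val_inj->.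
have -> : Vdih_set = [set f p | p : 'I_2 * 'I_2 * 'I_2].
  apply/setP=> x; rewrite inE; apply/existsP/imsetP=> [[w]|[[[w a] b] _ ->]].
    by case/existsP=> a /existsP[b /eqP->]; exists (w, a, b).
  by exists w; apply/existsP; exists a; apply/existsP; exists b.
by rewrite card_imset // !card_prod !card_ord.
Qed.

Lemma Vdih_gen : <<[set Vdih 0 0 1; Vdih 0 1 0]>> = Vdih_set.
Proof.
apply/eqP; rewrite eqEsubset gen_subG; apply/andP; split.
  by apply/subsetP=> x /set2P[]->; apply: Vdih_mem.
set G := <<_>>; have Gs : Vdih 0 0 1 \in G by rewrite mem_gen ?set21.
have Gt : Vdih 0 1 0 \in G by rewrite mem_gen ?set22.
have Gc : Vdih 1 0 0 \in G.
  (* The square of a product of two involutions is their commutator. *)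
  have <- : (Vdih 0 0 1 * Vdih 0 1 0) ^+ 2 = Vdih 1 0 0.
    by rewrite expgS expg1 !VdihM; apply/eqP; rewrite Vdih_eq.
  by rewrite groupX ?groupM.
apply/subsetP=> _ /Vdih_setP[w [a [b ->]]].
have X1 k : Vdih k 0 0 = Vdih 1 0 0 ^+ k.
  elim: k => [|k IHk]; first exact: Vdih1.
  by rewrite expgSr -IHk VdihM ?muln0 ?mul0n !addn0 addn1.
have X2 k : Vdih 0 k 0 = Vdih 0 1 0 ^+ k.
  elim: k => [|k IHk]; first exact: Vdih1.
  by rewrite expgSr -IHk VdihM ?muln0 ?mul0n !addn0 addn1.
have X3 k : Vdih 0 0 k = Vdih 0 0 1 ^+ k.
  elim: k => [|k IHk]; first exact: Vdih1.
  by rewrite expgSr -IHk VdihM ?muln0 ?mul0n !addn0 addn1.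
(* In this order of the factors no twist arises. *)
have -> : Vdih w a b = Vdih w 0 0 * (Vdih 0 a 0 * Vdih 0 0 b).
  by rewrite !VdihM !mul0n !addn0.
by rewrite X1 X2 X3 !groupM ?groupX.
Qed.

(** Two distinct involutions generate a dihedral group, here of order 8. *)
Lemma Vdih_isog : Vdih_set \isog [set: 'D_8].
Proof.
have eq1 x y z : (Vdih x y z == 1) = [&& x %% 2 == 0, y %% 2 == 0 & z %% 2 == 0]%N.
  by rewrite -Vdih1 Vdih_eq.
have := @involutions_gen_dihedral _ (Vdih 0 0 1) (Vdih 0 1 0).
rewrite Vdih_gen /= card_Vdih; apply; last by rewrite Vdih_eq.
all: apply: nt_prime_order; rewrite ?eq1 //.
all: by rewrite expgS expg1 VdihM; apply/eqP; rewrite eq1.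
Qed.
End DihedralPart.

(** * Morphisms out of a presented group *)

Section PresentationEval.
Variables (X : choiceType) (rel : seq (seq (X * bool) * seq (X * bool))).
Variables (gT : groupType) (g : X -> gT).

Definition word_eval (u : seq (X * bool)) : gT :=
  \prod_(l <- u) (if l.2 then (g l.1)^-1 else g l.1).

Hypothesis rel_eval : forall u v, (u, v) \in rel -> word_eval u = word_eval v.

Lemma word_eval_cong u v : pres_cong rel u v -> word_eval u = word_eval v.
Proof.
elim=> {u v} [u v /rel_eval // | x b | u u' v v' _ eq_u _ eq_v | // | // |].
- by rewrite /word_eval big_cons big_seq1 big_nil; case: b; rewrite /= ?mulgV ?mulVg.
- by rewrite /word_eval !big_cat /=; congr (_ * _).
- by move=> u v w _ -> _.
Qed.

(** Von Dyck's theorem: a class is evaluated on its chosen representative, and [word_eval_cong]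
    makes this choice harmless. *)
Lemma pres_morphism : exists phi : pres rel -> gT,
  {morph phi : a b / a * b} /\ forall x, phi (pres_gen rel x) = g x.
Proof.
exists (fun a => word_eval (pres_repr a)); split=> [a b | x].
  rewrite (word_eval_cong (pres_repr_cong _ _)).
  exact: big_cat.
by rewrite (word_eval_cong (pres_repr_cong _ _)) /word_eval big_seq1.
Qed.
End PresentationEval.

(** * The presentation of V_4 *)

Lemma pres_classM (X : choiceType) rel (u v : seq (X * bool)) :
  pres_class rel u * pres_class rel v = pres_class rel (u ++ v).
Proof. exact: pres_mul_class. Qed.

Lemma rs_rsr : rs_r * rs_s * rs_r = rs_s.
Proof.
rewrite /rs_r /rs_s /pres_gen (pres_classM _ [:: _] [:: _]) pres_classM.
by apply/pres_classP/PresRel; rewrite !inE eqxx.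
Qed.

Lemma rs_s2 : rs_s ^+ 2 = 1.
Proof.
rewrite expgS expg1 /rs_s /pres_gen pres_classM.
by apply/pres_classP/PresRel; rewrite !inE eqxx orbT.
Qed.

Lemma rs_r4 : rs_r ^+ 4 = 1.
Proof.
rewrite !expgS expg0 mulg1 /rs_r /pres_gen.
rewrite (pres_classM _ [:: _] [:: _]) (pres_classM _ [:: _] [:: _; _]) pres_classM.
by apply/pres_classP/PresRel; rewrite !inE eqxx !orbT.
Qed.

(** Multiplying r s r = s by r^3 on the left gives s r = r^3 s, since r^4 = 1; s then passes one r
    at a time. *)
Lemma rs_srX i : rs_s * rs_r ^+ i = rs_r ^+ (3 * i) * rs_s.
Proof.
have sr : rs_s * rs_r = rs_r ^+ 3 * rs_s.
  by rewrite -[in RHS]rs_rsr !mulgA -expgSr rs_r4 mul1g.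
elim: i => [|i IHi]; first by rewrite muln0 mulg1 mul1g.
by rewrite expgSr mulgA IHi -mulgA sr mulgA -expgD mulnS addnC.
Qed.

(** Prefixing a letter to r^i s^j gives such a product again, as s passes powers of r and the
    inverse letters are r^3 and s. This leaves at most eight elements. *)
Lemma rs_normal_form a : exists i j, [/\ i < 4, j < 2 & a = rs_r ^+ i * rs_s ^+ j].
Proof.
suff [i [j ->]] : exists i j, a = rs_r ^+ i * rs_s ^+ j.
  exists (i %% 4)%N, (j %% 2)%N; split; rewrite ?ltn_mod //.
  rewrite {1}(divn_eq i 4) {1}(divn_eq j 2) !expgD ![(_ %/ _ * _)%N]mulnC !expgM.
  by rewrite rs_r4 rs_s2 !expg1n !mul1g.
rewrite -[a]pres_reprK; elim: (pres_repr a) => [|l u [i [j IHu]]].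
  by exists 0%N, 0%N; rewrite mulg1.
have -> : pres_class _ (l :: u) =
    (pres_class _ [:: l] : rs_group) * (rs_r ^+ i * rs_s ^+ j).
  by rewrite -IHu (pres_classM _ [:: l] u).
have invE x : pres_class _ [:: (x, true)] = (pres_gen _ x)^-1 :> rs_group.
  apply: (mulIg (pres_gen _ x : rs_group)); rewrite mulVg.
  rewrite /pres_gen (pres_classM _ [:: _] [:: _]).
  exact/pres_classP/(PresInv _ x true).
have rV : rs_r^-1 = rs_r ^+ 3.
  by apply: (mulIg rs_r); rewrite mulVg -expgSr rs_r4.
have sV : rs_s^-1 = rs_s.
  by apply: (mulIg rs_s); rewrite mulVg -{1}[rs_s]expg1 -expgSr rs_s2.
have mul_s : rs_s * (rs_r ^+ i * rs_s ^+ j) = rs_r ^+ (3 * i) * rs_s ^+ j.+1.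
  by rewrite mulgA rs_srX -mulgA -expgS.
case: l => [[] []].
- exists (3 + i)%N, j; rewrite invE -/rs_r rV.
  by rewrite expgD mulgA.
- by exists i.+1, j; rewrite expgS -mulgA.
- by exists (3 * i)%N, j.+1; rewrite invE -/rs_s sV -mul_s.
- by exists (3 * i)%N, j.+1; rewrite -mul_s.
Qed.

Section VFour.
Variable He : 4 <= 4.
Local Notation R := (Vdih He 0 1 1).
Local Notation S := (Vdih He 0 0 1).

(** Multiplying R^i by R produces the twist i, and 0 + 1 + ... + (i-1) is the binomial coefficient;
    multiplying by S produces none. *)
Lemma Vdih_normal_form i j : R ^+ i * S ^+ j = Vdih He 'C(i, 2) i (i + j).
Proof.
have -> : R ^+ i = Vdih He 'C(i, 2) i i.
  elim: i => [|i IHi]; first by rewrite Vdih1.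
  by rewrite expgSr IHi VdihM binS bin1 muln1 addn0 !addn1.
have -> : S ^+ j = Vdih He 0 0 j.
  elim: j => [|j IHj]; first by rewrite Vdih1.
  by rewrite expgSr IHj VdihM muln0 addn1.
by rewrite VdihM muln0 !addn0.
Qed.

Lemma V4_presentation : exists psi : V He -> rs_group,
  [/\ {morph psi : x y / x * y}, bijective psi,
      psi (Vcls He 1 1 1) = rs_r & psi (Vcls He 1 0 1) = rs_s].
Proof.
(* The map is built from the presented group to V_4, where only the three relations need checking,
   and inverted afterwards. *)
have [|phi [phiM phi_gen]] := @pres_morphism _
   [:: ([:: (true, false); (false, false); (true, false)], [:: (false, false)]);
       ([:: (false, false); (false, false)], [::]);
       (nseq 4 (true, false), [::])] _ (fun x => if x then R else S).
  move=> u v; rewrite !inE => /or3P[] /eqP[-> ->];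
    rewrite /word_eval !big_cons ?big_nil /= ?mulg1 -?Vdih1 !VdihM;
    by apply/eqP; rewrite Vdih_eq.
have phi_r : phi rs_r = R by exact: phi_gen.
have phi_s : phi rs_s = S by exact: phi_gen.
have phi1 : phi 1 = 1.
  by apply: (mulgI (phi 1)); rewrite -phiM !mulg1.
have phiX a i : phi (a ^+ i) = phi a ^+ i.
  by elim: i => // i IHi; rewrite !expgS phiM IHi.
have phiE i j : phi (rs_r ^+ i * rs_s ^+ j) = Vdih He 'C(i, 2) i (i + j).
  by rewrite phiM !phiX phi_r phi_s Vdih_normal_form.
have phi_inj : injective phi.
  move=> a b; have [i [j [lt_i lt_j ->]]] := rs_normal_form a.
  have [i' [j' [lt_i' lt_j' ->]]] := rs_normal_form b.
  (* The eight normal forms have distinct images, by inspection. *)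
  move/eqP; rewrite !phiE Vdih_eq.
  by case: i lt_i => [|[|[|[|//]]]] _; case: j lt_j => [|[|//]] _;
    case: i' lt_i' => [|[|[|[|//]]]] _; case: j' lt_j' => [|[|//]] _.
have phi_surj x : exists a, phi a = x.
  have [a [b [c [lt_a lt_b lt_c odd_a ->]]]] := V_coords x.
  (* Here a is 1 or 3. The exponent i of r is b or b + 2, so i = b modulo 2 and C(i, 2) has the
     parity of [a./2]; adding c + b to i leaves c modulo 2. *)
  exists (rs_r ^+ (a./2 * 2 + b) * rs_s ^+ (c + b)); rewrite phiE.
  have -> : Vcls He a b c = Vdih He a./2 b c.
    by rewrite /Vdih -[in LHS](odd_double_half a) odd_a mul2n.
  apply/eqP; rewrite Vdih_eq.
  by case: a odd_a lt_a => [|[|[|[|//]]]] // _ _; case: b lt_b => [|[|//]] _;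
    case: c lt_c => [|[|//]] _.
have [psi psiK] := choice phi_surj.
exists psi; split.
- by move=> x y; apply: phi_inj; rewrite phiM !psiK.
- by exists phi => // a; apply: phi_inj; rewrite psiK.
- by apply: phi_inj; rewrite psiK phi_r /Vdih muln0 addn0.
- by apply: phi_inj; rewrite psiK phi_s /Vdih muln0 addn0.
Qed.

Lemma Vdih_set_full : Vdih_set He = [set: V He].
Proof.
by apply/eqP; rewrite eqEcard subsetT card_Vdih card_V.
Qed.
End VFour.

(** * The decomposition of V for e >= 5 *)

Lemma ucls_fiveX k j : ucls (2 ^ k) (5%:Z ^+ j)%R = five k ^+ j.
Proof.
apply: val_inj; rewrite val_fiveX val_ucls; last by rewrite abszX oddX orbT.
by rewrite rmorphXn /= natrX.
Qed.

Section VDecomposition.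
Variables (m : nat) (He : 4 <= m.+1.+4).
Local Notation C := (Vdih He 1 0 0).

(** Here e = m + 5, so 2^(e-5) is 2^m and 2^(e-4) is 2^(m+1). The image is central, since a factor
    with both last coordinates zero produces no twist. *)
Definition Vunit (u : {unit 'Z_(2 ^ m.+3)}) : V He := MkV He u 0%R 0%R.

Lemma Vunit_mul u v b c : Vunit u * MkV He v b c = MkV He (u * v) b c.
Proof.
by apply: V_inj; rewrite /= ?add0r // mul0n mulr0 addr0.
Qed.

Lemma Vunit_central u x : commute (Vunit u) x.
Proof.
case: x => v b c; rewrite /commute Vunit_mul.
by apply: V_inj; rewrite /= ?addr0 // muln0 mulr0 addr0 mulrC.
Qed.

Lemma VunitX u k : Vunit u ^+ k = Vunit (u ^+ k).
Proof.
elim: k => [|k IHk]; first by [].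
by rewrite !expgS IHk Vunit_mul.
Qed.

Lemma Vunit_inj : injective Vunit. Proof. by move=> u v []. Qed.

Local Notation F := (Vunit (five m.+3)).
Local Notation N := (Vunit (neg1 m.+3)).

(** Modulo 2^(m+3), 5^(2^m) equals 1 + 2^(m+2), the first coordinate of the commutator C: here the
    cyclic and the dihedral factor meet. *)
Lemma F_exp_half : F ^+ (2 ^ m) = C.
Proof.
rewrite VunitX; apply: V_inj => //.
by rewrite [LHS]five_exp_half /= val_ucls_nat ?Vdih_odd // muln1.
Qed.

Lemma order_F : #[F] = (2 ^ m.+1)%N.
Proof.
have <- := order_five (isT : 1 < m.+3).
apply/eqP; rewrite eqn_dvd !order_dvdn VunitX expg_order eqxx /=.
by rewrite -(inj_eq Vunit_inj) -VunitX expg_order.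
Qed.

Lemma C_exp k : C ^+ k = Vdih He k 0 0.
Proof.
elim: k => [|k IHk]; first exact/esym/Vdih1.
by rewrite expgS IHk VdihM !addn0 add1n.
Qed.

Lemma F_Vdih w a b :
  F ^+ w * Vdih He 0 a b = MkV He (five m.+3 ^+ w) (a%:R)%R (b%:R)%R.
Proof.
rewrite VunitX Vunit_mul; congr MkV; apply: val_inj => /=.
by rewrite val_ucls_nat ?Vdih_odd // muln0 mulr1.
Qed.

Lemma F_exp_Vdih w a b : F ^+ (2 ^ m * w) * Vdih He 0 a b = Vdih He w a b.
Proof. by rewrite expgM F_exp_half C_exp VdihM mul0n !addn0. Qed.

Lemma V_H1E : V_H1 He = Vdih_set He.
Proof.
apply/setP=> x.
rewrite [LHS]inE [RHS]inE; apply: eq_existsb => w; apply: eq_existsb => a.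
apply: eq_existsb => b; rewrite /Vcls ucls_fiveX -F_exp_Vdih F_Vdih.
have -> : (m.+1.+4 - 5 = m)%N by rewrite !subSS subn0.
by [].
Qed.

Lemma V_H2E : V_H2 He = <[F]>.
Proof.
apply/setP=> x; rewrite inE; apply/existsP/idP=> [[w /eqP->] | /cyclePmin[w]].
  by rewrite -[MkV _ _ _ _]VunitX mem_cycle.
by rewrite order_F => lt_w ->; exists (Ordinal lt_w); rewrite VunitX.
Qed.

Lemma Vdih_cent_F : <[F]> \subset 'C(Vdih_set He).
Proof.
by rewrite cycle_subG; apply/centP=> x _; apply: Vunit_central.
Qed.

Lemma V_HE : V_H He = Vdih_set He * <[F]>.
Proof.
rewrite -(centC Vdih_cent_F).
apply/setP=> x; rewrite inE; apply/existsP/mulsgP.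
  case=> w /existsP[a /existsP[b /eqP->]].
  by exists (F ^+ w) (Vdih He 0 a b); rewrite ?mem_cycle ?Vdih_mem // F_Vdih.
case=> y z /cyclePmin[w lt_w ->] /Vdih_setP[v [a [b ->]]] ->.
(* The first coordinate of the dihedral factor is that of a power of F and is absorbed into the
   exponent of F. *)
rewrite -F_exp_Vdih mulgA -expgD -expg_mod_order order_F.
have lt_k : (w + 2 ^ m * v) %% 2 ^ m.+1 < 2 ^ m.+1 by rewrite ltn_mod expn_gt0.
exists (Ordinal lt_k); apply/existsP; exists (inord (a %% 2)).
apply/existsP; exists (inord (b %% 2)); rewrite F_Vdih; apply/eqP.
by congr MkV; apply/eqP; rewrite Z2_natr_eq inordK ?ltn_mod // modn_mod.
Qed.

Lemma V_H_cprod : V_H1 He \* V_H2 He = V_H He.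
Proof.
by rewrite V_H1E V_H2E V_HE; apply: cprodE Vdih_cent_F.
Qed.

Lemma V_H_group_set : group_set (V_H He).
Proof. by rewrite V_HE; apply/comm_group_setP/commute_sym/centC/Vdih_cent_F. Qed.

Lemma V_H1_group_set : group_set (V_H1 He).
Proof. by rewrite V_H1E groupP. Qed.

Lemma V_H2_group_set : group_set (V_H2 He).
Proof. by rewrite V_H2E groupP. Qed.

Canonical V_H_group := Group V_H_group_set.

(** First coordinates in H are powers of 5, and -1 is not one. *)
Lemma neg1_notin_H : N \notin V_H He.
Proof.
rewrite inE; apply/existsP=> -[w /existsP[a /existsP[b /eqP[eq_u _ _]]]].
have [_ _ _ ti] := dprodP (unit_exp2_dprod (isT : 1 < m.+3)).
have : neg1 m.+3 \in <[neg1 m.+3]> :&: <[five m.+3]>.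
  by rewrite inE cycle_id eq_u mem_cycle.
rewrite ti inE => /eqP eq1; have := order_neg1 (isT : 1 < m.+3).
by rewrite eq1 order1.
Qed.

Lemma order_N : #[N] = 2.
Proof.
apply: nt_prime_order => //; last first.
  by apply: contraNneq neg1_notin_H => ->; apply: group1.
by rewrite VunitX; have := expg_order (neg1 m.+3); rewrite order_neg1 // => ->.
Qed.

(** Writing the first coordinate as a power of -1 times a power of 5 splits off the central
    involution N. *)
Lemma V_dprod : <[N]> \x V_H He = [set: V He].
Proof.
rewrite dprodE /=.
- apply/setP=> x; rewrite [RHS]inE; case: x => u b c.
  have [_ [_ [/cycleP[i ->] /cycleP[j ->] -> _]]] :=
    mem_dprod (unit_exp2_dprod (isT : 1 < m.+3)) (in_setT u).
  rewrite -Vunit_mul -VunitX mem_mulg ?mem_cycle // V_HE -(centC Vdih_cent_F).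
  have [b' _ ->] := Z2_natr b; have [c' _ ->] := Z2_natr c.
  by rewrite -F_Vdih mem_mulg ?mem_cycle ?Vdih_mem.
- by rewrite centsC cycle_subG; apply/centP=> x _; apply: Vunit_central.
by apply: prime_TIg; rewrite -?orderE ?order_N // cycle_subG neg1_notin_H.
Qed.
End VDecomposition.

(** * Central products *)

Lemma Zp_expgM (gT : finGroupType) (x : gT) q : 1 < q -> #[x] = q ->
  {morph (fun y : 'Z_q => x ^+ y) : y z / y * z}.
Proof.
move=> q_gt1 ox y z; rewrite -expgD -(expg_mod_order x (y + z)) ox.
by congr (_ ^+ (_ %% _)%N); apply: Zp_cast.
Qed.

(** The images commute, so (x, y) maps to f1 x * f2 y by a morphism onto the product; its kernel is
    the diagonal, and the first isomorphism theorem applies. *)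
Lemma ext_cprod_isog (C G1 G2 gT : finGroupType) (i1 : C -> G1) (i2 : C -> G2)
    (H1 H2 : {group gT}) (f1 : {morphism [set: G1] >-> gT})
    (f2 : {morphism [set: G2] >-> gT}) :
  H2 \subset 'C(H1) -> f1 @* [set: G1] = H1 -> f2 @* [set: G2] = H2 ->
  (forall x y, (f1 x * f2 y == 1) = ((x, y) \in central_diag i1 i2)) ->
  H1 * H2 \isog ext_cprod i1 i2.
Proof.
move=> cH12 im1 im2 ker12; pose f (p : G1 * G2) := f1 p.1 * f2 p.2.
have cf x y : commute (f1 x) (f2 y).
  apply/commute_sym/(centsP cH12).
    by rewrite -im2 mem_morphim ?inE.
  by rewrite -im1 mem_morphim ?inE.
have fM : {in [set: G1 * G2] &, {morph f : p q / p * q}}.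
  move=> p q _ _; rewrite /f /= !morphM ?inE //.
  by rewrite !mulgA -[_ * f2 p.2]mulgA (cf q.1 p.2) mulgA.
have <- : Morphism fM @* [set: G1 * G2] = H1 * H2.
  apply/setP=> z; apply/morphimP/mulsgP => [[[x y] _ _ ->]|[u v]].
    by exists (f1 x) (f2 y); rewrite -?im1 -?im2 ?mem_morphim ?inE.
  rewrite -im1 -im2 => /morphimP[x _ _ ->{u}] /morphimP[y _ _ ->{v}] ->.
  by exists (x, y); rewrite ?inE.
have kerE : 'ker (Morphism fM) = central_diag i1 i2.
  by apply/setP=> -[x y]; rewrite -ker12 !inE.
by rewrite /ext_cprod -kerE isog_sym; apply: first_isog.
Qed.

(** An embedding of Z/2 is determined by the image of the generator, which must be a central
    involution. *)
Lemma central_embedding_uniq (G : finGroupType) (i j : 'Z_2 -> G) :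
    {in 'Z([set: G]) &, forall x y,
      x != 1 -> y != 1 -> x ^+ 2 = 1 -> y ^+ 2 = 1 -> x = y} ->
  central_embedding i -> central_embedding j -> i =1 j.
Proof.
move=> uniq_inv [iM inj_i Zi] [jM inj_j Zj] c.
have map1 (h : 'Z_2 -> G) : {morph h : x y / x * y} -> h 1 = 1.
  by move=> hM; apply: (mulgI (h 1)); rewrite -hM !mulg1.
have [c1 | c_neq1] := eqVneq c 1; first by rewrite c1 !map1.
have cc : c * c = 1 by case: c {c_neq1} => [[|[|//]] ?]; apply: val_inj.
apply: uniq_inv => //.
- by rewrite -(map1 i iM) (inj_eq inj_i).
- by rewrite -(map1 j jM) (inj_eq inj_j).
- by rewrite expgS expg1 -iM cc map1.
- by rewrite expgS expg1 -jM cc map1.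
Qed.

Lemma center_dihedral8 : #|'Z([set: 'D_8])| = 2.
Proof.
have [[x y] gen _] :=
  @generators_2dihedral _ [group of [set: 'D_8]] 3 isT (isog_refl _).
have [_ _ _ _ [-> //]] := @dihedral2_structure _ _ 3 x y isT gen (isog_refl _).
Qed.

Lemma dihedral8_central_involution :
  {in 'Z([set: 'D_8]) &, forall x y : 'D_8, x != 1 -> y != 1 -> x = y}.
Proof.
move=> x y Zx Zy x1 y1; apply/eqP.
have /cards2P[a [b [_ Zab]]] : #|'Z([set: 'D_8])| == 2.
  by rewrite center_dihedral8.
have : 1 \in 'Z([set: 'D_8]) by apply: group1.
move: Zx Zy; rewrite Zab !inE => /orP[]/eqP Ex /orP[]/eqP Ey /orP[]/eqP E1;
  move: x1 y1; rewrite Ex Ey E1 ?eqxx //.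
Qed.

(** Additively, z + z = 0 makes z a multiple of 2^k, and 2^k is the only nonzero one below
    2^(k+1). *)
Lemma Zp_exp2_involution k (x y : 'Z_(2 ^ k.+1)) :
  x != 1 -> y != 1 -> x ^+ 2 = 1 -> y ^+ 2 = 1 -> x = y.
Proof.
have inv_val (z : 'Z_(2 ^ k.+1)) : z != 1 -> z ^+ 2 = 1 -> z = (2 ^ k)%:R%R.
  have gt1 : 1 < 2 ^ k.+1 by rewrite (ltn_exp2l 0).
  rewrite -[z]natr_Zp; have : z < 2 ^ k.+1 by rewrite -[X in _ < X](Zp_cast gt1).
  move: (nat_of_ord z) => {z} z lt_z z1; rewrite expgS expg1 => z2.
  have : ((z + z)%:R == 0 :> 'Z_(2 ^ k.+1))%R by rewrite natrD; apply/eqP/z2.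
  rewrite Zp_exp2_eq0 // addnn -mul2n expnS dvdn_pmul2l // => /dvdnP[q def_z].
  move: z1 lt_z; rewrite def_z expnS ltn_pmul2r ?expn_gt0 //.
  by case: q {def_z} => [|[|//]]; rewrite ?mul0n ?mul1n ?eqxx.
by move=> x1 y1 x2 y2; rewrite (inv_val x) // (inv_val y).
Qed.

Lemma expg_Z2_natr (gT : finGroupType) (x : gT) k : #[x] = 2 ->
  x ^+ ((k%:R)%R : 'Z_2) = x ^+ k.
Proof. by move=> ox; rewrite val_Zp_nat // -ox expg_mod_order. Qed.

Lemma expg_central_embedding (G : finGroupType) (x : G) :
  #[x] = 2 -> x \in 'Z([set: G]) -> central_embedding (fun c : 'Z_2 => x ^+ c).
Proof.
move=> ox Zx; split=> [||c]; [exact: Zp_expgM | | exact: groupX].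
move=> c d /eqP; rewrite eq_expg_mod_order ox !modn_small.
- by move/eqP/val_inj.
- exact: (ltn_ord d).
exact: (ltn_ord c).
Qed.

(** * The external central product for e >= 5 *)

Section VCentralProduct.
Variables (m : nat) (He : 4 <= m.+1.+4).
Local Notation C := (Vdih He 1 0 0).
Local Notation F := (Vunit He (five m.+3)).

Lemma C_sqr : C * C = 1.
Proof. by rewrite VdihM -Vdih1; apply/eqP; rewrite Vdih_eq. Qed.

Lemma order_C : #[C] = 2.
Proof. by apply: nt_prime_order; [|exact: C_sqr | rewrite -(Vdih1 He) Vdih_eq]. Qed.

(** Powers of F have both last coordinates zero, which leaves only powers of C in the dihedral
    part. *)
Lemma Vdih_cap_F x : x \in Vdih_set He -> x \in <[F]> -> exists w, x = C ^+ w.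
Proof.
move=> /Vdih_setP[w [a [b ->]]] /cycleP[k]; rewrite VunitX => -[_ a0 b0].
exists w; rewrite C_exp; apply/eqP; rewrite Vdih_eq eqxx /=.
by rewrite -!Z2_natr_eq a0 b0 !eqxx.
Qed.

(** Both embeddings send the generator of Z/2 to the preimage of the shared involution C: d in the
    dihedral group, h = 2^m in the cyclic one. These are the only central involutions, whence
    uniqueness. *)
Lemma V_H_ext_cprod : exists (iota1 : 'Z_2 -> 'D_8) (iota2 : 'Z_2 -> 'Z_(2 ^ m.+1)),
  [/\ central_embedding iota1,
      forall i : 'Z_2 -> 'D_8, central_embedding i -> i =1 iota1,
      central_embedding iota2,
      forall i : 'Z_2 -> 'Z_(2 ^ m.+1), central_embedding i -> i =1 iota2
    & V_H He \isog ext_cprod iota1 iota2].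
Proof.
have gt1 : 1 < 2 ^ m.+1 by rewrite (ltn_exp2l 0).
have /isogP[f1 inj_f1 im_f1] : [set: 'D_8] \isog Vdih_set He.
  by rewrite isog_sym Vdih_isog.
have [d _ Cd] : exists2 d : 'D_8, d \in [set: 'D_8] & C = f1 d.
  have : C \in f1 @* [set: 'D_8] by rewrite im_f1 Vdih_mem.
  by case/morphimP=> d _ ? ->; exists d.
have od : #[d] = 2 by rewrite -(order_injm inj_f1) ?inE // -Cd order_C.
have C_central y : commute C y by rewrite -F_exp_half VunitX; apply: Vunit_central.
have Zd : d \in 'Z([set: 'D_8]).
  apply/centerP; split=> [|y _]; first by rewrite inE.
  apply: (injmP inj_f1); rewrite ?inE // !morphM ?inE // -Cd; exact: C_central.
pose f2 := Morphism (in2W (Zp_expgM gt1 (order_F He)) :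
  {in [set: 'Z_(2 ^ m.+1)] &,
    {morph (fun y : 'Z_(2 ^ m.+1) => F ^+ y) : y z / y * z}}).
have [h f2h] : exists h, f2 h = C.
  exists (2 ^ m)%:R%R; rewrite /= val_Zp_nat // modn_small ?F_exp_half //.
  by rewrite ltn_exp2l.
have inj_f2 : 'injm f2.
  apply/injmP=> y z _ _ /= /eqP; rewrite eq_expg_mod_order order_F !modn_small.
  - by move/eqP/val_inj.
  - by rewrite -[X in _ < X](Zp_cast gt1).
  by rewrite -[X in _ < X](Zp_cast gt1).
have cardZ : #|[set: 'Z_(2 ^ m.+1)]| = (2 ^ m.+1)%N.
  by rewrite cardsT card_ord; apply: Zp_cast.
have im_f2 : f2 @* [set: 'Z_(2 ^ m.+1)] = <[F]>.
  apply/eqP; rewrite eqEcard card_injm // cardZ.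
  rewrite -orderE order_F leqnn andbT.
  by apply/subsetP=> _ /morphimP[y _ _ ->]; apply: mem_cycle.
have oh : #[h] = 2 by rewrite -(order_injm inj_f2) ?inE // f2h order_C.
have Zh : h \in 'Z([set: 'Z_(2 ^ m.+1)]).
  apply/centerP; split=> [|y _]; first by rewrite inE.
  by apply: (injmP inj_f2); rewrite ?inE // !morphM ?inE // f2h; apply: C_central.
have emb1 := expg_central_embedding od Zd.
have emb2 := expg_central_embedding oh Zh.
exists (fun c => d ^+ c), (fun c => h ^+ c); split=> //.
- move=> i emb_i; apply: central_embedding_uniq => // x y Zx Zy x1 y1 _ _.
  exact: dihedral8_central_involution.
- move=> i emb_i; apply: central_embedding_uniq => // x y _ _.
  exact: Zp_exp2_involution.
rewrite V_HE; apply: (ext_cprod_isog (Vdih_cent_F He) im_f1 im_f2) => x y.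
apply/eqP/imsetP => [fxy1 | [c _ [-> ->]]]; last first.
  by rewrite !morphX ?inE // f2h -Cd -expgMn // C_sqr expg1n.
(* In the kernel, f1 x lies in both factors and is a power C^w; as C is its own inverse, the same w
   serves both components. *)
have f2y : f2 y = (f1 x)^-1 by apply/esym/eqP; rewrite eq_invg_mul fxy1.
have [|| w f1x] := @Vdih_cap_F (f1 x).
- by rewrite -im_f1 mem_morphim ?inE.
- by rewrite -groupV -f2y mem_cycle.
exists (w%:R)%R => //; rewrite !expg_Z2_natr //; congr (_, _).
  by apply: (injmP inj_f1); rewrite ?inE // morphX ?inE // -Cd.
apply: (injmP inj_f2); rewrite ?inE // morphX ?inE // f2h f2y f1x.
by rewrite -expgVn; congr (_ ^+ _); apply/eqP; rewrite eq_invg_mul C_sqr.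
Qed.

Lemma V_isog_ext_cprod (iota1 : 'Z_2 -> 'D_8) (iota2 : 'Z_2 -> 'Z_(2 ^ m.+1)) :
  V_H He \isog ext_cprod iota1 iota2 ->
  [set: V He] \isog setX [set: 'Z_2] (ext_cprod iota1 iota2).
Proof.
move=> isoH; apply: isog_dprod (V_dprod He) (setX_dprod _ _) _ _.
  rewrite -morphim_pairg1; apply: isog_trans (_ : _ \isog [set: 'Z_2]) _.
    rewrite isog_cyclic_card ?cycle_cyclic // -orderE order_N.
    by rewrite prime_cyclic cardsT card_ord.
  exact: sub_isog (subsetT _) (injm_pairg1 _ _).
rewrite -morphim_pair1g; apply: isog_trans isoH _.
exact: sub_isog (subsetT _) (injm_pair1g _ _).
Qed.
End VCentralProduct.

(** * Assembly of the three statements and the order *)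

Theorem theorem2p12 (e : nat) (He : 4 <= e) :
  [/\ (* (1) *)
      [/\ forall t, exptriple e t -> exists! f : autU e, chi_spec t f,
          forall f : autU e, exists2 t, exptriple e t & chi_spec t f
        & exists Phi : autU e -> V He,
            [/\ forall t1 t2 t3 (f : autU e),
                  exptriple e (t1, t2, t3) -> chi_spec (t1, t2, t3) f ->
                  Phi f = Vcls He t3 t2 (t1 %/ 2 ^ (e - 3)),
                {morph Phi : f g / f * g}
              & bijective Phi]],
      (* (2) *)
      e = 4 ->
        [set: autU e] \isog [set: 'D_8] /\
        exists psi : V He -> rs_group,
          [/\ {morph psi : x y / x * y}, bijective psi,
              psi (Vcls He 1 1 1) = rs_r & psi (Vcls He 1 0 1) = rs_s],
      (* (3) *)
      5 <= e ->
        [/\ exists (iota1 : 'Z_2 -> 'D_8)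
                   (iota2 : 'Z_2 -> 'Z_(2 ^ (e - 4))),
              [/\ central_embedding iota1,
                  forall i : 'Z_2 -> 'D_8, central_embedding i -> i =1 iota1,
                  central_embedding iota2,
                  forall i : 'Z_2 -> 'Z_(2 ^ (e - 4)),
                    central_embedding i -> i =1 iota2
                & [set: autU e] \isog
                    setX [set: 'Z_2] (ext_cprod iota1 iota2)],
            group_set (V_H He),
            <[Vcls He (- 1)%R 0 0]> \x V_H He = [set: V He],
            group_set (V_H1 He) /\ group_set (V_H2 He)
          & V_H1 He \* V_H2 He = V_H He]
    & #|[set: autU e]| = (2 ^ (e - 1))%N].
Proof.
have [n def_e] : exists n, e = n.+4 by exists (e - 4)%N; rewrite -addn4 subnK.
subst e; have [Phi [PhiE PhiM bij_Phi]] := Phi_exists He.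
have isoV := bij_morph_isog PhiM bij_Phi.
split; last by rewrite (card_isog isoV) card_V.
- by split; [exact: chi_exists | exact: chi_surj | exists Phi].
- case=> n0; subst n; split; last exact: V4_presentation.
  by have := Vdih_isog He; rewrite Vdih_set_full; apply: isog_trans isoV.
case: n He Phi PhiE PhiM bij_Phi isoV => // m {}He _ _ _ _ isoV _.
split.
- have [iota1 [iota2 [emb1 uniq1 emb2 uniq2 isoH]]] := V_H_ext_cprod He.
  exists iota1, iota2; split=> //.
  exact: isog_trans isoV (V_isog_ext_cprod isoH).
- exact: V_H_group_set.
- exact: V_dprod.
- by split; [exact: V_H1_group_set | exact: V_H2_group_set].
exact: V_H_cprod.
Qed.
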